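(* For every $d\geq 1$, the logic $\mathsf{C}^{(0,d+1)}$ identifies every colored graph of tree-depth at most $d$; that is, for every colored graph $G$ with $\operatorname{td}(G)\leq d$ and every colored graph $H$ not isomorphic to $G$, there is a sentence of $\mathsf{C}^{(0,d+1)}$ that holds in exactly one of $G$ and $H$.
   Context: Colored graphs are finite simple graphs with a vertex coloring; isomorphisms preserve edges, non-edges and colors. First-order logic with counting $\mathsf{C}$ has atomic formulas $x=y$, $E(x,y)$, $U_c(x)$, Boolean connectives, and quantifiers $\forall,\exists,\exists^{\geq n}$ ($n\in\mathbb{N}$). A variable $x$ is requantified in $\varphi$ if it is both free and bound in $\varphi$, or $\varphi$ has a subformula $Qx\,\psi$ where $\psi$ has a subformula $Q'x\,\chi$ ($Q,Q'$ quantifiers). $\mathsf{C}^{(0,k)}$ is the set of $\mathsf{C}$-formulas with variables in $\{y_1,\dots,y_k\}$ in which no variable is requantified. Tree-depth: if $G_1,\dots,G_p$ are the connected components of $G$, then $\operatorname{td}(G)=1$ if $|V(G)|=1$; $\operatorname{td}(G)=1+\min_{v\in V(G)}\operatorname{td}(G-v)$ if $p=1$ and $|V(G)|>1$; and $\operatorname{td}(G)=\max_{i\in[p]}\operatorname{td}(G_i)$ otherwise. *)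

(* Defs.v *)
From mathcomp Require Import all_boot.
Set Implicit Arguments.
Unset Strict Implicit.
Unset Printing Implicit Defensive.

Record cgraph (C : eqType) := CGraph {
  vertex :> finType;
  edge : rel vertex;
  color : vertex -> C;
  edge_sym : symmetric edge;
  edge_irr : irreflexive edge
}.

Definition isomorphic (C : eqType) (G H : cgraph C) : Prop :=
  exists f : G -> H,
    [/\ bijective f,
        forall u v, edge (f u) (f v) = edge u v &
        forall u, color (f u) = color u].

Section TreeDepth.
Variables (C : eqType) (G : cgraph C).
Implicit Types A B : {set G}.

(* Subgraphs of G are represented by their vertex sets: A stands for G[A]. *)
Definition edge_in A : rel G :=
  [rel u v | [&& u \in A, v \in A & edge u v]].

Definition components A : {set {set G}} :=
  equivalence_partition (connect (edge_in A)) A.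

(* The recursion is on n, and n = #|A| steps always suffice. The default value
   #|A| of the minimum is never attained, as td (G[A] - v) <= #|A| - 1.
   The recursion equations are td_set_card1, td_set_connected and
   td_set_components below. *)
Fixpoint td_rec (n : nat) A : nat :=
  if n is m.+1 then
    if #|A| == 1 then 1
    else if #|components A| == 1 then
      (\big[minn/#|A|]_(v in A) td_rec m (A :\ v)).+1
    else \max_(B in components A) td_rec m B
  else 0.

Definition td_set A : nat := td_rec #|A| A.

Lemma edge_in_sym A : connect_sym (edge_in A).
Proof.
by apply: sym_connect_sym => u v; rewrite /edge_in /= edge_sym andbCA.
Qed.

Lemma edge_in_equiv A :
  {in A & &, equivalence_rel (connect (edge_in A))}.
Proof.
move=> x y z _ _ _; split; first exact: connect0.
by move=> xy; apply: (same_connect (@edge_in_sym A)).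
Qed.

Lemma components_partition A : partition (components A) A.
Proof. exact/equivalence_partitionP/edge_in_equiv. Qed.

Lemma components_proper A B :
  #|components A| != 1 -> B \in components A -> B \proper A.
Proof.
move=> n1 BC; have partA := components_partition A.
have [/eqP covA /trivIsetP trA n0] := and3P partA.
have BA : B \subset A by rewrite -covA; apply: (bigcup_sup B).
rewrite properEneq BA andbT; apply: contra n1 => /eqP eBA; apply/cards1P.
exists B; apply/setP => D; rewrite inE; apply/idP/eqP => [DC|->//].
apply/eqP; apply: contraT => nDB.
have := trA _ _ DC BC nDB; rewrite eBA disjoints_subset => sD.
have DA : D \subset A by rewrite -covA; apply: (bigcup_sup D).
have D0 : D = set0.
  by apply/eqP; rewrite -subset0 -(setICr A) subsetI DA.
by rewrite -D0 DC in n0.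
Qed.

Lemma components_set0 : components set0 = set0.
Proof. by rewrite /components /equivalence_partition imset0. Qed.

Lemma td_rec_fuel m n A : #|A| <= m -> #|A| <= n -> td_rec m A = td_rec n A.
Proof.
elim: m n A => [|m IH] [|n] A //= Am An.
- move: Am; rewrite leqn0 cards_eq0 => /eqP ->.
  by rewrite components_set0 !cards0 /= big_set0.
- move: An; rewrite leqn0 cards_eq0 => /eqP ->.
  by rewrite components_set0 !cards0 /= big_set0.
case: ifP => // _; case: ifP => [_|/negbT n1].
  congr _.+1; apply: eq_bigr => v vA.
  by apply: IH; rewrite -ltnS; apply: leq_trans (proper_card (properD1 vA)) _.
apply: eq_bigr => B BA; have pB := proper_card (components_proper n1 BA).
by apply: IH; rewrite -ltnS; apply: leq_trans pB _.
Qed.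

Lemma td_set0 : td_set set0 = 0.
Proof. by rewrite /td_set cards0. Qed.

Lemma td_set_rec A : A != set0 ->
  td_set A = if #|A| == 1 then 1
    else if #|components A| == 1 then
      (\big[minn/#|A|]_(v in A) td_set (A :\ v)).+1
    else \max_(B in components A) td_set B.
Proof.
rewrite -card_gt0 {1}/td_set => A0.
rewrite -(prednK A0) /= (prednK A0).
case: ifP => // _; case: ifP => [_|/negbT n1].
  congr _.+1; apply: eq_bigr => v vA; apply: td_rec_fuel => //.
  by rewrite -ltnS prednK //; apply: proper_card (properD1 vA).
apply: eq_bigr => B BA; apply: td_rec_fuel => //.
by rewrite -ltnS prednK //; apply: proper_card (components_proper n1 BA).
Qed.

Lemma bigmin_le (B : {set G}) (F : G -> nat) k v :
  v \in B -> \big[minn/k]_(u in B) F u <= F v.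
Proof.
move=> vB; elim: (index_enum G) (mem_index_enum v) => //= a s IH.
rewrite inE big_cons => /orP[/eqP<-|/IH le]; first by rewrite vB geq_minl.
by case: ifP => // _; apply: leq_trans le; apply: geq_minr.
Qed.

Lemma bigmin_attained (B : {set G}) (F : G -> nat) k v :
  v \in B -> F v <= k ->
  exists2 u, u \in B & \big[minn/k]_(u in B) F u = F u.
Proof.
move=> vB Fk; set m := \big[_/_]_(_ in _) _.
have : m <= F v by apply: bigmin_le.
have [->|//] : m = k \/ exists2 u, u \in B & m = F u; last first.
  by move=> kF; exists v => //; apply/eqP; rewrite eqn_leq kF.
rewrite /m; elim/big_rec: _ => [|u n uB IH]; first by left.
by rewrite /minn; case: ifP => _ //; right; exists u.
Qed.

Lemma td_set_le A : td_set A <= #|A|.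
Proof.
elim: {A}#|A| {-2}A (leqnn #|A|) => [|n IH] A An.
  by move: An; rewrite leqn0 cards_eq0 => /eqP ->; rewrite td_set0.
have [->|A0] := eqVneq A set0; first by rewrite td_set0.
rewrite td_set_rec //; case: eqP => [->//|_]; case: eqP => [_|/eqP n1].
  have [v vA] := set0Pn _ A0; have := cardsD1 v A; rewrite vA add1n => cA.
  rewrite cA ltnS; apply: leq_trans (bigmin_le _ _ vA) (IH _ _).
  by rewrite -ltnS -cA.
apply/bigmax_leqP => B BA; have pB := proper_card (components_proper n1 BA).
by apply: leq_trans (IH _ _) (ltnW pB); rewrite -ltnS (leq_trans pB).
Qed.

Lemma td_set_card1 A : #|A| = 1 -> td_set A = 1.
Proof. by move=> A1; rewrite td_set_rec ?A1 // -card_gt0 A1. Qed.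

Lemma td_set_connected A : 1 < #|A| -> #|components A| = 1 ->
  (exists2 v, v \in A & td_set A = (td_set (A :\ v)).+1) /\
  (forall v, v \in A -> td_set A <= (td_set (A :\ v)).+1).
Proof.
move=> A1 c1; have A0 : A != set0 by rewrite -card_gt0 ltnW.
rewrite td_set_rec // gtn_eqF // c1 eqxx; split=> [|v vA]; last first.
  by rewrite ltnS bigmin_le.
have [v vA] := set0Pn _ A0.
have le : td_set (A :\ v) <= #|A|.
  by apply: leq_trans (td_set_le _) (subset_leq_card (subsetDl _ _)).
have [u uA ->] := bigmin_attained (F := fun v => td_set (A :\ v)) vA le.
by exists u.
Qed.

Lemma td_set_components A : #|components A| != 1 ->
  td_set A = \max_(B in components A) td_set B.
Proof.
have [->|A0] := eqVneq A set0; first by rewrite components_set0 td_set0 big_set0.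
move=> n1; rewrite td_set_rec //; case: eqP => [|_]; last by rewrite (negPf n1).
move/eqP/cards1P => [x eA]; case/negP: n1.
by rewrite eA /components /equivalence_partition imset_set1 cards1.
Qed.

End TreeDepth.

Definition td (C : eqType) (G : cgraph C) : nat := td_set [set: G].

Inductive quantifier := QForall | QExists | QAtLeast of nat.

(* The variable y_i is represented by the number i. *)
Inductive formula (C : Type) :=
| FEq of nat & nat
| FEdge of nat & nat
| FColor of C & nat
| FNot of formula C
| FAnd of formula C & formula C
| FOr of formula C & formula C
| FImp of formula C & formula C
| FIff of formula C & formula C
| FQuant of quantifier & nat & formula C.

Arguments FEq {C}.
Arguments FEdge {C}.

Section Syntax.
Variable C : Type.
Implicit Types phi psi chi : formula C.

Fixpoint free_vars phi : seq nat :=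
  match phi with
  | FEq x y | FEdge x y => [:: x; y]
  | FColor _ x => [:: x]
  | FNot psi => free_vars psi
  | FAnd psi chi | FOr psi chi | FImp psi chi | FIff psi chi =>
      free_vars psi ++ free_vars chi
  | FQuant _ x psi => [seq y <- free_vars psi | y != x]
  end.

Fixpoint bound_vars phi : seq nat :=
  match phi with
  | FEq _ _ | FEdge _ _ | FColor _ _ => [::]
  | FNot psi => bound_vars psi
  | FAnd psi chi | FOr psi chi | FImp psi chi | FIff psi chi =>
      bound_vars psi ++ bound_vars chi
  | FQuant _ x psi => x :: bound_vars psi
  end.

Fixpoint subformula (theta phi : formula C) : Prop :=
  theta = phi \/
  match phi with
  | FEq _ _ | FEdge _ _ | FColor _ _ => False
  | FNot psi | FQuant _ _ psi => subformula theta psi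
  | FAnd psi chi | FOr psi chi | FImp psi chi | FIff psi chi =>
      subformula theta psi \/ subformula theta chi
  end.

Definition sentence phi : Prop := free_vars phi = [::].

Definition requantified (x : nat) phi : Prop :=
  (x \in free_vars phi /\ x \in bound_vars phi) \/
  exists q psi q' chi,
    subformula (FQuant q x psi) phi /\ subformula (FQuant q' x chi) psi.

Definition C0 (k : nat) phi : Prop :=
  (forall x, x \in free_vars phi ++ bound_vars phi -> 1 <= x <= k) /\
  (forall x, ~ requantified x phi).

End Syntax.

Section Semantics.
Variables (C : eqType) (G : cgraph C).

(* Assignments are partial so that sentences can be evaluated in the graph
   without vertices. *)
Definition assignment := nat -> option G.

Definition update (a : assignment) (x : nat) (v : G) : assignment :=
  fun y => if y == x then Some v else a y.

Fixpoint sat (a : assignment) (phi : formula C) : bool :=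
  match phi with
  | FEq x y =>
      if (a x, a y) is (Some u, Some v) then u == v else false
  | FEdge x y =>
      if (a x, a y) is (Some u, Some v) then edge u v else false
  | FColor c x => if a x is Some u then color u == c else false
  | FNot psi => ~~ sat a psi
  | FAnd psi chi => sat a psi && sat a chi
  | FOr psi chi => sat a psi || sat a chi
  | FImp psi chi => sat a psi ==> sat a chi
  | FIff psi chi => sat a psi == sat a chi
  | FQuant QForall x psi => [forall v, sat (update a x v) psi]
  | FQuant QExists x psi => [exists v, sat (update a x v) psi]
  | FQuant (QAtLeast n) x psi => n <= #|[set v | sat (update a x v) psi]|
  end.

Definition models (phi : formula C) : bool := sat (fun=> None) phi.

End Semantics.

Definition identifies (C : eqType) (L : formula C -> Prop) (G : cgraph C) :
    Prop :=
  forall H : cgraph C, ~ isomorphic G H ->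
  exists phi : formula C,
    [/\ L phi, sentence phi & models G phi (+) models H phi].

(* Main.v *)
(* Formulas of quantifier rank k are governed by the k-round bijective pebble
   game, and a Hintikka formula of G of rank d+1 expresses that Duplicator wins
   on (G, H). So let Duplicator win; by induction on k, if k+1 rounds remain and
   S is a union of components of G minus the pebbles with td(S) <= k, then S is
   isomorphic, over the pebbles, to a union of components of H minus the pebbles.
   For a component X = {x} + S with x and its answer y already pebbled, the
   induction hypothesis applies to S = X - x, and the image of S contains all
   unpebbled neighbours of y because Duplicator's bijection preserves the degree
   of x. For several components, pebbling a root v of a component B (a vertex
   with td(B - v) < k) yields a component of H isomorphic to B;
   isomorphic components have equally many roots, so counting roots shows that H
   has at least as many components of each isomorphism type as S. *)

Require Import Defs.
From mathcomp Require Import all_boot.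
From mathcomp.classical Require Import boolp.
Set Implicit Arguments.
Unset Strict Implicit.
Unset Printing Implicit Defensive.

(** * Injections obtained by counting *)

(** The first hypothesis makes the sets [N i], for [i] in [A], pairwise equal or disjoint. Each
    class of indices with a common [N i] can thus be embedded into that set separately, by position
    in the enumerations. This serves both for components of graphs and for vertices. *)
Lemma class_injection (I J : finType) (A : {set I}) (T : I -> J -> bool)
    (dflt : I -> J) :
  (forall i i' j j', i \in A -> i' \in A ->
     T i j -> T i' j -> T i' j' -> T i j') ->
  (forall i, i \in A ->
     #|[set i' in A | [set j | T i' j] == [set j | T i j]]|
       <= #|[set j | T i j]|) ->
  exists2 h : I -> J, {in A &, injective h} & {in A, forall i, T i (h i)}.
Proof.
move=> zig le; pose N i := [set j | T i j].
pose M i := [set i' in A | N i' == N i].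
pose h i := nth (dflt i) (enum (N i)) (index i (enum (M i))).
have lt i : i \in A -> index i (enum (M i)) < size (enum (N i)).
  move=> iA; rewrite -cardE; apply: leq_trans (le i iA).
  by rewrite cardE index_mem mem_enum inE iA /=.
have hN i : i \in A -> T i (h i).
  by move=> /lt /(mem_nth (dflt i)); rewrite mem_enum inE.
exists h => // i i' iA i'A eh.
have Ti := hN _ iA; have Ti' := hN _ i'A; rewrite -eh in Ti'.
have eN : N i = N i'.
  by apply/setP=> j; rewrite !inE; apply/idP/idP => ?;
    [exact: (zig i' i (h i)) | exact: (zig i i' (h i))].
have eM : M i = M i' by rewrite /M eN.
have lt' := lt _ i'A; have lt0 := lt _ iA.
move: eh; rewrite /h eM eN (set_nth_default (dflt i')); last by rewrite -eN -eM.
move/eqP; rewrite nth_uniq ?enum_uniq //; last by rewrite -eN -eM.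
have iM : i \in enum (M i') by rewrite mem_enum inE iA; apply/eqP.
by move/eqP; apply: (index_inj i iM); rewrite mem_enum inE i'A /=.
Qed.

Lemma card_fibers (T I : finType) (c : T -> I) (U : {set T}) (B : {set I}) n :
  (forall u, u \in U -> c u \in B) ->
  (forall i, i \in B -> #|[set u in U | c u == i]| = n) ->
  #|U| = #|B| * n.
Proof.
move=> UB fib; rewrite -sum1_card (partition_big c (mem B)) //= -sum_nat_const.
apply: eq_bigr => i /fib <-; rewrite -sum1_card.
by apply: eq_bigl => u; rewrite !inE.
Qed.

(** * Connected components and tree-depth *)

Section Components.
Variables (C : eqType) (G : cgraph C).
Implicit Types (S T : {set G}) (x y z : G).

Definition component S x : {set G} := [set y | connect (edge_in S) x y].

Lemma mem_component S x : x \in component S x.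
Proof. by rewrite inE connect0. Qed.

(** Packages induction along paths: later arguments only have to exhibit a set closed under
    edges. *)
Lemma component_min S T x : x \in T ->
  (forall u v, u \in T -> u \in S -> v \in S -> edge u v -> v \in T) ->
  component S x \subset T.
Proof.
move=> xT cl; apply/subsetP => y; rewrite inE => /connectP[p].
elim: p x xT => [x xT _ ->//|z p IH x xT] /= /andP[/and3P[xS zS xz]] pp ly.
exact: IH (cl _ _ xT xS zS xz) pp ly.
Qed.

Lemma component_sub S x : x \in S -> component S x \subset S.
Proof. by move=> xS; apply: component_min. Qed.

Lemma component_closed S x u v :
  u \in component S x -> u \in S -> v \in S -> edge u v -> v \in component S x.
Proof.
rewrite !inE => xu uS vS uv; apply: connect_trans xu (connect1 _).
by rewrite /edge_in /= uS vS.
Qed.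

Lemma component_eq S x y : y \in component S x -> component S y = component S x.
Proof.
rewrite inE => xy; apply/setP=> z; rewrite !inE.
by rewrite (same_connect (@edge_in_sym _ _ S) xy).
Qed.

Lemma component_closed_eq S T x : T \subset S -> x \in T ->
  (forall u v, u \in T -> v \in S -> edge u v -> v \in T) ->
  component T x = component S x.
Proof.
move=> TS xT cl; apply/eqP; rewrite eqEsubset; apply/andP; split.
  apply: component_min => [|u v uS uT vT]; first exact: mem_component.
  by apply: component_closed => //; apply: (subsetP TS).
apply: component_min => [|u v uT uS vS uv]; first exact: mem_component.
have uT' : u \in T by apply: (subsetP (component_sub xT)).
by apply: component_closed uT uT' (cl _ _ uT' vS uv) uv.
Qed.

Lemma component_comp S x : x \in S ->
  component (component S x) x = component S x.
Proof.
move=> xS.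
apply: component_closed_eq; [exact: component_sub | exact: mem_component |].
move=> u v uC; apply: (component_closed uC).
exact: (subsetP (component_sub xS)).
Qed.

Lemma component_in_components S x : x \in S -> component S x \in components S.
Proof.
move=> xS; apply/imsetP; exists x => //; apply/setP=> y; rewrite !inE.
apply/idP/andP => [xy|[]//]; split=> //.
by apply: (subsetP (component_sub xS)); rewrite inE.
Qed.

(** Tree-depth at most [k], with connected and disconnected sets in one clause. A singleton needs no
    case of its own, because level 0 is the empty set. *)
Fixpoint tdle k S : bool :=
  if k is k'.+1 then
    [forall x in S, exists v in component S x, tdle k' (component S x :\ v)]
  else S == set0.

Lemma td_set_tdle S k : td_set S <= k -> tdle k S.
Proof.
elim: {S}#|S| {-2}S (leqnn #|S|) k => [|n IH] S Sn k.
  move: Sn; rewrite leqn0 cards_eq0 => /eqP -> _.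
  by case: k => [|k] /=; rewrite ?eqxx //; apply/forall_inP=> x; rewrite inE.
have [->|S0] := eqVneq S set0.
  by case: k => [|k] /= _; rewrite ?eqxx //; apply/forall_inP=> x; rewrite inE.
have [c1|c1] := eqVneq #|components S| 1.
  have [v vS le] : exists2 v, v \in S & td_set S = (td_set (S :\ v)).+1.
    (* [td_set_connected] requires two vertices, so a singleton is treated apart. *)
    have [S1|S1] := leqP #|S| 1.
      have /cards1P[v eS] : #|S| == 1 by rewrite eqn_leq S1 card_gt0.
      exists v; first by rewrite eS set11.
      by rewrite td_set_card1 ?eS ?cards1 // setDv td_set0.
    by case: (td_set_connected S1 c1).
  rewrite le; case: k => // k; rewrite ltnS => lek /=.
  apply/forall_inP => x xS; have -> : component S x = S.
    have /cards1P[D eD] := introT eqP c1.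
    have := component_in_components xS; rewrite eD inE => /eqP eC.
    have [/eqP] := and3P (components_partition S).
    by rewrite eD /cover big_set1 -eC.
  apply/exists_inP; exists v => //; apply: IH => //.
  by rewrite -ltnS; apply: leq_trans Sn; apply: proper_card (properD1 vS).
rewrite td_set_components // => /bigmax_leqP le.
have comple x : x \in S -> tdle k (component S x).
  move=> xS; have xC := component_in_components xS.
  apply: IH (le _ xC); rewrite -ltnS; apply: leq_trans Sn.
  exact: proper_card (components_proper c1 xC).
case: k comple {le} => [|k] comple.
  have [x xS] := set0Pn _ S0; have /eqP e0 := comple _ xS.
  by have := mem_component S x; rewrite e0 inE.
apply/forall_inP => x xS; have /forall_inP/(_ x) := comple _ xS.
by rewrite component_comp // mem_component; apply.
Qed.

Definition td_roots k S : {set G} := [set v in S | tdle k (S :\ v)].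

Lemma in_td_roots k S v : (v \in td_roots k S) = (v \in S) && tdle k (S :\ v).
Proof. by rewrite in_set. Qed.

Definition unpebbled (a : seq G) : {set G} := [set u | u \notin a].

(** These are the unions of components of [G] minus the pebbles, described by closure so that no
    family of components has to be named. *)
Definition region (a : seq G) S : Prop :=
  S \subset unpebbled a /\
  (forall u v, u \in S -> v \notin a -> edge u v -> v \in S).

Lemma region_comp a S x : region a S -> x \in S ->
  component S x = component (unpebbled a) x.
Proof.
case=> sub cl xS; apply: component_closed_eq => // u v uS.
by rewrite inE; apply: cl.
Qed.

Lemma component_region a x : x \notin a -> region a (component (unpebbled a) x).
Proof.
move=> xa; have xU : x \in unpebbled a by rewrite inE.
have sub := component_sub xU.
split=> // u v uC va; apply: (component_closed uC); last by rewrite inE.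
exact: (subsetP sub).
Qed.

(* Loops being excluded, the default value [u] of [nth] makes this false for
   indices beyond the last pebble. *)
Definition adj (a : seq G) i u := edge (nth u a i) u.

End Components.

(** * Isomorphisms between regions *)

(* [R] is the graph of an isomorphism from [G[S]] to [H[D]] that also preserves
   adjacency to the pebbles; relations avoid default values for the inverse. *)
Record region_iso (C : eqType) (G H : cgraph C) (a : seq G) (b : seq H)
    (S : {set G}) (D : {set H}) (R : G -> H -> bool) : Prop := RegionIso {
  riso_sub : forall u w, R u w -> u \in S /\ w \in D;
  riso_dom : forall u, u \in S -> exists w, R u w;
  riso_ran : forall w, w \in D -> exists u, R u w;
  riso_eq : forall u w u' w', R u w -> R u' w' -> (u == u') = (w == w');
  riso_edge : forall u w u' w', R u w -> R u' w' -> edge u u' = edge w w';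
  riso_color : forall u w, R u w -> color u = color w;
  riso_adj : forall u w, R u w -> forall i, adj a i u = adj b i w
}.

Section RegionIso.
Variable C : eqType.

Lemma riso_sym (G H : cgraph C) (a : seq G) (b : seq H) S D R :
  region_iso a b S D R -> region_iso b a D S (fun w u => R u w).
Proof.
case=> sub dom ran eqR edR colR adjR; split=> //.
- by move=> w u /sub[].
- by move=> w u w' u' r r'; rewrite (eqR _ _ _ _ r r').
- by move=> w u w' u' r r'; rewrite (edR _ _ _ _ r r').
- by move=> w u /colR.
- by move=> w u /adjR.
Qed.

Lemma riso_trans (F G H : cgraph C) (a : seq F) (b : seq G) (c : seq H)
    S D E R Q :
  region_iso a b S D R -> region_iso b c D E Q ->
  region_iso a c S E (fun u w => [exists v, R u v && Q v w]).
Proof.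
case=> sub dom ran eqR edR colR adjR [sub' dom' ran' eqQ edQ colQ adjQ].
split.
- by move=> u w /existsP[v /andP[/sub[? _] /sub'[]]].
- move=> u /dom[v Ruv]; have [_ /dom'[w Qvw]] := sub _ _ Ruv.
  by exists w; apply/existsP; exists v; rewrite Ruv.
- move=> w /ran'[v Qvw]; have [/ran[u Ruv] _] := sub' _ _ Qvw.
  by exists u; apply/existsP; exists v; rewrite Ruv.
- move=> u w u' w' /existsP[v /andP[r q]] /existsP[v' /andP[r' q']].
  by rewrite (eqR _ _ _ _ r r') (eqQ _ _ _ _ q q').
- move=> u w u' w' /existsP[v /andP[r q]] /existsP[v' /andP[r' q']].
  by rewrite (edR _ _ _ _ r r') (edQ _ _ _ _ q q').
- by move=> u w /existsP[v /andP[/colR -> /colQ ->]].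
- by move=> u w /existsP[v /andP[r q]] i; rewrite (adjR _ _ r) (adjQ _ _ q).
Qed.

Variables (G H : cgraph C) (a : seq G) (b : seq H).

Lemma riso_restrict S D R (A : {set G}) (B : {set H}) :
  region_iso a b S D R -> A \subset S -> B \subset D ->
  (forall u w, R u w -> (u \in A) = (w \in B)) ->
  region_iso a b A B (fun u w => R u w && (u \in A)).
Proof.
case=> sub dom ran eqR edR colR adjR AS BD AB; split.
- by move=> u w /andP[r uA]; rewrite -(AB _ _ r).
- by move=> u uA; have [w r] := dom _ (subsetP AS _ uA); exists w; rewrite r.
- move=> w wB; have [u r] := ran _ (subsetP BD _ wB).
  by exists u; rewrite r (AB _ _ r).
- by move=> u w u' w' /andP[r _] /andP[r' _]; apply: eqR.
- by move=> u w u' w' /andP[r _] /andP[r' _]; apply: edR.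
- by move=> u w /andP[/colR].
- by move=> u w /andP[/adjR].
Qed.

Lemma riso_card_le S D R (A : {set G}) (B : {set H}) :
  region_iso a b S D R -> A \subset S ->
  (forall u w, R u w -> u \in A -> w \in B) -> #|A| <= #|B|.
Proof.
(* Values in [option H] spare a default vertex, which an empty [H] would not have. *)
move=> iso AS AB; pose f u := [pick w | R u w].
have fP u : u \in A -> exists2 w, f u = Some w & R u w.
  move=> uA; have [w r] := riso_dom iso (subsetP AS _ uA).
  by rewrite /f; case: pickP => [w' r'|/(_ w)]; [exists w' | rewrite r].
have inj : {in A &, injective f}.
  move=> u u' /fP[w -> r] /fP[w' -> r'] [eww]; apply/eqP.
  by rewrite (riso_eq iso r r') eww.
rewrite -(card_in_imset inj) -(card_imset (mem B) (@Some_inj _)).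
apply: subset_leq_card; apply/subsetP => _ /imsetP[u uA ->].
by have [w -> r] := fP _ uA; apply: imset_f; apply: AB r uA.
Qed.

Lemma riso_comp S D R u w v v' :
  region_iso a b S D R -> R u w -> R v v' ->
  v \in component S u -> v' \in component D w.
Proof.
(* [T] is the preimage of the component of [w]. It is closed under edges of [S], hence contains the
   component of [u]. *)
move=> iso ruw rvv; set T := [set x | [exists y in component D w, R x y]].
have /subsetP sub : component S u \subset T.
  apply: component_min => [|x z]; rewrite !inE.
    by apply/exists_inP; exists w; rewrite ?mem_component.
  move=> /exists_inP[y yD rxy] _ zS xz; have [z' rzz] := riso_dom iso zS.
  apply/exists_inP; exists z' => //; apply: component_closed yD _ _ _.
  - by case: (riso_sub iso rxy).
  - by case: (riso_sub iso rzz).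
  - by rewrite -(riso_edge iso rxy rzz).
move/sub; rewrite inE => /exists_inP[y yD rvy].
by have := riso_eq iso rvv rvy; rewrite eqxx => /esym/eqP ->.
Qed.

End RegionIso.

(** * Invariance of components, tree-depth and roots under isomorphism *)

Section RootCount.
Variables (C : eqType) (G H : cgraph C) (a : seq G) (b : seq H).

Lemma riso_compE S D R u w v v' :
  region_iso a b S D R -> R u w -> R v v' ->
  (v \in component S u) = (v' \in component D w).
Proof.
move=> iso ruw rvv; apply/idP/idP; first exact: riso_comp iso ruw rvv.
exact: (riso_comp (riso_sym iso)).
Qed.

Lemma tdle_iso k S D R : region_iso a b S D R -> tdle k S -> tdle k D.
Proof.
elim: k S D R => [|k IH] S D R iso /=.
  move=> /eqP S0; apply/eqP/setP => w; rewrite inE.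
  apply/negP => /(riso_ran iso).
  by case=> u /(riso_sub iso)[]; rewrite S0 inE.
move/forall_inP => tdS; apply/forall_inP => w wD.
have [u ruw] := riso_ran iso wD; have [uS _] := riso_sub iso ruw.
have /exists_inP[v vC tdv] := tdS _ uS.
have vS := subsetP (component_sub uS) _ vC; have [v' rvv] := riso_dom iso vS.
apply/exists_inP; exists v'; first by rewrite -(riso_compE iso ruw rvv).
apply: IH tdv; apply: (riso_restrict iso).
- exact: subset_trans (subsetDl _ _) (component_sub uS).
- exact: subset_trans (subsetDl _ _) (component_sub wD).
move=> x y rxy; rewrite !in_setD1 (riso_eq iso rxy rvv).
by rewrite (riso_compE iso ruw rxy).
Qed.

Lemma riso_roots k S D R u w :
  region_iso a b S D R -> R u w -> u \in td_roots k S -> w \in td_roots k D.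
Proof.
move=> iso ruw; rewrite !inE => /andP[uS tdu].
have [_ wD] := riso_sub iso ruw; rewrite wD /=.
apply: tdle_iso tdu; apply: (riso_restrict iso); try exact: subsetDl.
move=> x y rxy; rewrite !in_setD1 (riso_eq iso rxy ruw).
by have [-> ->] := riso_sub iso rxy.
Qed.

Lemma riso_card_roots_le k S D R :
  region_iso a b S D R -> #|td_roots k S| <= #|td_roots k D|.
Proof.
move=> iso; apply: (riso_card_le iso).
  by apply/subsetP=> u; rewrite inE => /andP[].
by move=> u w; apply: riso_roots iso.
Qed.

End RootCount.

Lemma riso_card_roots (C : eqType) (G H : cgraph C) (a : seq G) (b : seq H)
    k S D R :
  region_iso a b S D R -> #|td_roots k S| = #|td_roots k D|.
Proof.
move=> iso; apply/eqP; rewrite eqn_leq (riso_card_roots_le k iso).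
exact: riso_card_roots_le (riso_sym iso).
Qed.

(** * The bijective pebble game *)

(* The i-th pebble, counted from 0, interprets the variable y_(i+1). *)
Definition asg (C : eqType) (G : cgraph C) (a : seq G) : assignment G :=
  fun x => if x is i.+1 then onth a i else None.

(** The indices range over all numbers, placed or not: [FEq i i] holds exactly when pebble [i] is
    placed, so agreement forces equal lengths. *)
Definition agree (C : eqType) (G H : cgraph C) (a : seq G) (b : seq H) : Prop :=
  [/\ forall i j, sat (asg a) (FEq i j) = sat (asg b) (FEq i j),
      forall i j, sat (asg a) (FEdge i j) = sat (asg b) (FEdge i j) &
      forall c i, sat (asg a) (FColor c i) = sat (asg b) (FColor c i)].

(* Duplicator wins the k-round bijective game from the position (a, b). *)
Fixpoint eqv (C : eqType) (G H : cgraph C) k (a : seq G) (b : seq H) : Prop :=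
  agree a b /\
  if k is k'.+1 then
    exists2 f : G -> H, bijective f &
      forall v, eqv k' (rcons a v) (rcons b (f v))
  else True.

Section Game.
Variable C : eqType.

Lemma onth_rcons (T : Type) (s : seq T) x i :
  onth (rcons s x) i =
  if i < size s then onth s i else if i == size s then Some x else None.
Proof.
rewrite -cats1 onth_cat; case: ltnP => // si.
by rewrite eqn_leq si andbT -subn_eq0; case: (i - size s) => //= n; rewrite onth0n.
Qed.

Lemma sat_eq_refl (G : cgraph C) (a : seq G) i :
  sat (asg a) (FEq i.+1 i.+1) = (i < size a).
Proof. by rewrite -onthTE /=; case: onth => //= u; rewrite eqxx. Qed.

Lemma agree_size (G H : cgraph C) (a : seq G) (b : seq H) :
  agree a b -> size a = size b.
Proof.
case=> E _ _; have lt i : (i < size a) = (i < size b).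
  by rewrite -!sat_eq_refl E.
apply/eqP; rewrite eqn_leq; move: (lt (size a)) (lt (size b)); rewrite !ltnn.
by move=> /esym/negbT; rewrite -leqNgt => -> /negbT; rewrite -leqNgt => ->.
Qed.

Lemma agree_sym (G H : cgraph C) (a : seq G) (b : seq H) :
  agree a b -> agree b a.
Proof. by case=> ? ? ?; split. Qed.

Lemma eqv_agree (G H : cgraph C) k (a : seq G) (b : seq H) :
  eqv k a b -> agree a b.
Proof. by case: k => [|k] []. Qed.

Lemma eqv_step (G H : cgraph C) k (a : seq G) (b : seq H) :
  eqv k.+1 a b -> exists2 f : G -> H, bijective f &
    forall v, eqv k (rcons a v) (rcons b (f v)).
Proof. by case. Qed.

Lemma eqv_refl (G : cgraph C) k (a : seq G) : eqv k a a.
Proof.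
by elim: k a => [|k IH] a /=; split=> //; exists id => //; exists id.
Qed.

Lemma eqv_sym (G H : cgraph C) k (a : seq G) (b : seq H) :
  eqv k a b -> eqv k b a.
Proof.
elim: k a b => [|k IH] a b /= [ag]; first by split; first exact: agree_sym.
case=> f [g fg gf] E; split; first exact: agree_sym.
by exists g; [exists f | move=> w; apply: IH; rewrite -{2}(gf w)].
Qed.

Lemma agree_trans (F G H : cgraph C) (a : seq F) (b : seq G) (c : seq H) :
  agree a b -> agree b c -> agree a c.
Proof.
by case=> E1 E2 E3 [E1' E2' E3']; split=> *; rewrite ?E1 ?E2 ?E3.
Qed.

Lemma eqv_trans (F G H : cgraph C) k (a : seq F) (b : seq G) (c : seq H) :
  eqv k a b -> eqv k b c -> eqv k a c.
Proof.
elim: k a b c => [|k IH] a b c /= [ag E] [ag' E'].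
  by split; first exact: agree_trans ag ag'.
split; first exact: agree_trans ag ag'.
case: E E' => f bf E [g bg E']; exists (g \o f); first exact: bij_comp.
by move=> v; apply: IH (E v) (E' (f v)).
Qed.

Section Pebble.
Variables (G H : cgraph C) (a : seq G) (b : seq H) (v : G) (w : H).
Hypothesis ag : agree (rcons a v) (rcons b w).

Lemma agree_rcons_size : size a = size b.
Proof. by have := agree_size ag; rewrite !size_rcons => -[]. Qed.

Lemma agree_mem : (v \in a) = (w \in b).
Proof.
have es := agree_rcons_size; case: ag => E _ _.
(* Membership among the older pebbles is an equality between the newest pebble and one of them,
   hence visible to [agree]. *)
have memE (K : cgraph C) (s : seq K) x : reflect
    (exists2 i, i < size s & sat (asg (rcons s x)) (FEq i.+1 (size s).+1))
    (x \in s).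
  apply: (iffP onthP) => [[i e]|[i lt]] /=.
    have lt : i < size s by rewrite -onthTE e.
    by exists i => //; rewrite !onth_rcons lt ltnn eqxx e.
  rewrite !onth_rcons lt ltnn eqxx; case e: onth => [y|] // /eqP yx.
  by exists i; rewrite e yx.
apply/memE/memE => -[i lt s]; exists i.
- by rewrite -es.
- by rewrite -E -es.
- by rewrite es.
- by rewrite E es.
Qed.

Lemma agree_color : color v = color w.
Proof.
have es := agree_rcons_size; case: ag => _ _ /(_ (color v) (size a).+1) /=.
by rewrite !onth_rcons -es ltnn !eqxx => /esym/eqP.
Qed.

Lemma agree_adj i : adj a i v = adj b i w.
Proof.
have es := agree_rcons_size; have [lt|le] := ltnP i (size a); last first.
  by rewrite /adj !nth_default ?edge_irr // -es.
case: ag => _ /(_ i.+1 (size a).+1) /= + _.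
rewrite !onth_rcons -es ltnn eqxx lt /adj.
rewrite -!odflt_onth; move: (lt); rewrite -onthTE; case: (onth a i) => // u _.
by move: lt; rewrite es -onthTE; case: (onth b i).
Qed.

End Pebble.

Lemma adj_rcons_last (G : cgraph C) (a : seq G) x u :
  adj (rcons a x) (size a) u = edge x u.
Proof. by rewrite /adj nth_rcons ltnn eqxx. Qed.

Lemma adj_rcons (G : cgraph C) (a : seq G) x i u : i != size a ->
  adj (rcons a x) i u = adj a i u.
Proof.
move=> ne; rewrite /adj nth_rcons (negPf ne); case: ltnP => // le.
by rewrite nth_default.
Qed.

End Game.

(** * From winning strategies to isomorphisms *)

Section Reconstruction.
Variables (C : eqType) (G H : cgraph C).
Implicit Types (a : seq G) (b : seq H).

(** The round in excess of [k] is what allows the degree of a root to be compared once it is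
    pebbled. *)
Definition transfer k : Prop := forall a b S,
  eqv k.+1 a b -> region a S -> tdle k S ->
  exists D R, region b D /\ region_iso a b S D R.

(** The root [x] is already pebbled when the rounds are counted, but the isomorphism is taken over
    the older pebbles and includes [x] in its domain. *)
Definition rooted_transfer k : Prop := forall a b x y,
  x \notin a -> eqv k.+1 (rcons a x) (rcons b y) ->
  tdle k (component (unpebbled a) x :\ x) ->
  exists R,
    region_iso a b (component (unpebbled a) x) (component (unpebbled b) y) R /\
    R x y.

(** Adjacency to the last pebble, which the given isomorphism preserves, is exactly the edge
    relation between the new vertex and [S]. *)
Lemma riso_add_root a b x y (S : {set G}) (D : {set H}) R :
  x \notin S -> y \notin D ->
  agree (rcons a x) (rcons b y) ->
  region_iso (rcons a x) (rcons b y) S D R ->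
  region_iso a b (x |: S) (y |: D)
    (fun u w => (u == x) && (w == y) || R u w).
Proof.
move=> xS yD ag [sub dom ran eqR edR colR adjR].
have es := agree_rcons_size ag.
have out u w : R u w -> (u != x) /\ (w != y).
  move=> /sub[uS wD].
  by split; [apply: contraNneq xS => <- | apply: contraNneq yD => <-].
have root_edge u w : R u w -> edge x u = edge y w.
  move=> r; have := adjR _ _ r (size a).
  by rewrite adj_rcons_last es adj_rcons_last.
split.
- move=> u w /orP[/andP[/eqP-> /eqP->]|/sub[uS wD]]; first by rewrite !setU11.
  by rewrite !inE uS wD !orbT.
- move=> u; rewrite !inE => /orP[/eqP->|/dom[w r]]; first by exists y; rewrite !eqxx.
  by exists w; rewrite r orbT.
- move=> w; rewrite !inE => /orP[/eqP->|/ran[u r]]; first by exists x; rewrite !eqxx.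
  by exists u; rewrite r orbT.
- move=> u w u' w' /orP[/andP[/eqP-> /eqP->]|r] /orP[/andP[/eqP-> /eqP->]|r'].
  + by rewrite !eqxx.
  + have [/negPf ne /negPf ne'] := out _ _ r'.
    by rewrite eq_sym ne eq_sym ne'.
  + by have [/negPf -> /negPf ->] := out _ _ r.
  + exact: eqR.
- move=> u w u' w' /orP[/andP[/eqP-> /eqP->]|r] /orP[/andP[/eqP-> /eqP->]|r'].
  + by rewrite !edge_irr.
  + exact: root_edge.
  + by rewrite edge_sym (root_edge _ _ r) edge_sym.
  + exact: edR.
- move=> u w /orP[/andP[/eqP-> /eqP->]|/colR//]; exact: agree_color ag.
- move=> u w /orP[/andP[/eqP-> /eqP->]|r] i; first exact: agree_adj.
  (* The index [size a] names the root in the extended tuples but lies beyond [a] and [b], where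
     both sides are false. *)
  have [->|ne] := eqVneq i (size a).
    by rewrite {2}es /adj !nth_default ?edge_irr.
  by have := adjR _ _ r i; rewrite !adj_rcons // -es.
Qed.

(* Duplicator's bijection preserves the number of neighbours of the root, so the
   neighbours already matched by [transfer] are all of them. *)
Lemma transfer_rooted k : transfer k -> rooted_transfer k.
Proof.
move=> tr a b x y xa E tdX.
set X := component _ x in tdX *; set S := X :\ x in tdX.
have [subX clX] := component_region xa; rewrite -/X in subX clX.
have regS : region (rcons a x) S.
  split.
    apply/subsetP => u; rewrite in_setD1 => /andP[ux uX].
    by have := subsetP subX _ uX; rewrite !inE mem_rcons inE negb_or ux.
  move=> u v; rewrite mem_rcons inE negb_or !in_setD1 => /andP[_ uX] /andP[-> va].
  exact: clX.
have [D [R [[subD clD] iso]]] := tr _ _ _ E regS tdX.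
have ag := eqv_agree E; have yb : y \notin b by rewrite -(agree_mem ag).
have Db w : w \in D -> (w != y) /\ (w \notin b).
  by move/(subsetP subD); rewrite inE mem_rcons inE negb_or => /andP.
have yD : y \notin D by apply/negP => /Db[]; rewrite eqxx.
have xS : x \notin S by rewrite !inE eqxx.
have := riso_add_root xS yD ag iso.
have -> : x |: S = X by rewrite setD1K // mem_component.
set Q := fun _ => _; move=> isoX.
have Qxy : Q x y by rewrite /Q !eqxx.
exists Q; split=> //.
suff clY : forall u v, u \in y |: D -> v \notin b -> edge u v -> v \in y |: D.
  suff -> : component (unpebbled b) y = y |: D by [].
  have subY : y |: D \subset unpebbled b.
    by apply/subsetP => w; rewrite !inE => /orP[/eqP->//|/Db[]].
  have clY' u v : u \in y |: D -> v \in unpebbled b -> edge u v -> v \in y |: D.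
    by move=> uD; rewrite inE; apply: clY.
  rewrite -(component_closed_eq subY (setU11 _ _) clY').
  apply/eqP; rewrite eqEsubset component_sub ?setU11 //=.
  apply/subsetP => w wD; have [u q] := riso_ran isoX wD.
  have [uX _] := riso_sub isoX q.
  have := riso_compE isoX Qxy q; rewrite {1}/X component_comp -/X ?inE // => <-.
  by move: uX; rewrite inE.
move=> u v uYD vb uv; rewrite !inE; case: eqVneq => //= vy.
move: uYD; rewrite !inE => /orP[/eqP uy|uD]; last first.
  by apply: clD uD _ uv; rewrite mem_rcons inE negb_or vy.
rewrite {u}uy in uv.
have [f [g fg gf] Ef] := eqv_step E.
(* Only edges leaving [y] remain. [NX] and [NY] collect the neighbours of [x] and [y] outside the
   older pebbles; [f] matches them, as it respects adjacency to the last pebble and membership among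
   the pebbles. *)
pose NX := [set z | edge x z && (z \notin a)].
pose NY := [set z | edge y z && (z \notin b)].
have fN z : (f z \in NY) = (z \in NX).
  have agz := eqv_agree (Ef z); rewrite !inE.
  have := agree_adj agz (size a).
  rewrite adj_rcons_last (agree_rcons_size ag) adj_rcons_last => <-.
  have [xz|] := boolP (edge x z) => //=.
  have := agree_mem agz; rewrite !mem_rcons !inE.
  have -> : (z == x) = false by apply: contraTF xz => /eqP->; rewrite edge_irr.
  have -> : (f z == y) = false.
    apply: contraTF xz => /eqP fzy; have := agree_adj agz (size a).
    by rewrite adj_rcons_last (agree_rcons_size ag) adj_rcons_last fzy edge_irr => ->.
  by move=> /= ->.
have cNY : #|NY| <= #|NX|.
  rewrite -(card_imset _ (can_inj gf)); apply: subset_leq_card.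
  by apply/subsetP => _ /imsetP[z zN ->]; rewrite -fN gf.
have NXS : NX \subset S.
  apply/subsetP => z; rewrite !inE => /andP[xz za].
  rewrite (contraTneq _ xz) => [|->]; last by rewrite edge_irr.
  by have := clX _ _ (mem_component _ _) za xz; rewrite inE.
(* The isomorphism already embeds all of [NX] into [NY :&: D]; with [cNY] this leaves no element of
   [NY] outside [D]. *)
have cNX : #|NX| <= #|NY :&: D|.
  apply: (riso_card_le iso NXS) => p q r; rewrite !inE => /andP[xp _].
  have [_ qD] := riso_sub iso r; have [_ ->] := Db _ qD.
  have := riso_edge isoX Qxy (_ : Q p q); rewrite xp qD => <- //.
  by rewrite /Q r orbT.
have /eqP eN : NY :&: D == NY.
  by rewrite eqEcard subsetIl (leq_trans cNY cNX).
have : v \in NY by rewrite inE uv.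
by rewrite -eN inE => /andP[].
Qed.


(** * Matching and gluing components *)

(** Decided classically, because [class_injection] expects a Boolean relation. *)
Definition iso_regions a b (B : {set G}) (D : {set H}) : bool :=
  `[< exists R, region_iso a b B D R >].

Lemma iso_regions_zigzag a b B B' D D' :
  iso_regions a b B D -> iso_regions a b B' D -> iso_regions a b B' D' ->
  iso_regions a b B D'.
Proof.
move=> /asboolP[R r] /asboolP[Q q] /asboolP[P p]; apply/asboolP.
by eexists; apply: riso_trans r (riso_trans (riso_sym q) p).
Qed.

(* Counting roots: a component isomorphic to [B] contains exactly
   [#|td_roots k B|] of them, and Duplicator's bijection maps the roots of the
   components of type [B] injectively to roots of components of the same type. *)
Lemma component_matching k a b S :
  rooted_transfer k -> eqv k.+2 a b -> region a S -> tdle k.+1 S ->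
  exists2 h : {set G} -> {set H},
    {in [set component S u | u in S] &, injective h} &
    {in S, forall u, exists2 w, w \notin b &
      h (component S u) = component (unpebbled b) w /\
      iso_regions a b (component S u) (h (component S u))}.
Proof.
move=> tr /eqv_step[f bf Ef] regS /forall_inP tdS.
pose CG := component (unpebbled a); pose CH := component (unpebbled b).
have [subS clS] := regS.
have CS u : u \in S -> component S u = CG u by apply: region_comp.
pose PS := [set component S u | u in S].
pose PH := [set CH w | w in unpebbled b].
(* Restricting to [PH] ensures that only genuine components of [H] minus the pebbles are counted as
   partners. *)
pose T B D := (D \in PH) && iso_regions a b B D.
have rootT u : u \in S -> u \in td_roots k (CG u) ->
    T (CG u) (CH (f u)) /\ (f u \notin b) /\ f u \in td_roots k (CH (f u)).
  move=> uS ru; have ua : u \notin a by have := subsetP subS _ uS; rewrite inE.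
  have tdu : tdle k (CG u :\ u) by move: ru; rewrite in_td_roots => /andP[].
  have [R [iso r]] := tr _ _ _ _ ua (Ef u) tdu.
  have fb : f u \notin b by rewrite -(agree_mem (eqv_agree (Ef u))).
  split; last by split=> //; apply: riso_roots iso r ru.
  by rewrite /T imset_f ?inE //=; apply/asboolP; exists R.
have PSroot B : B \in PS -> exists2 v, v \in td_roots k B & v \in S /\ B = CG v.
  move=> /imsetP[u uS ->]; have /exists_inP[v vC tdv] := tdS _ uS.
  have vS := subsetP (component_sub uS) _ vC.
  exists v; first by rewrite in_td_roots vC.
  by rewrite -CS // (component_eq vC).
have zig B B' D D' : B \in PS -> B' \in PS ->
    T B D -> T B' D -> T B' D' -> T B D'.
  move=> _ _ /andP[_ i1] /andP[_ i2] /andP[D'P i3]; rewrite /T D'P.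
  exact: iso_regions_zigzag i1 i2 i3.
have [|h injh hT] := class_injection (fun=> set0) zig.
  move=> B0 B0P; set Bs := [set B in PS | _]; set Ds := [set D | T B0 D].
  have [v0 rv0 [v0S eB0]] := PSroot _ B0P.
  have Troots B D : T B D -> #|td_roots k B| = #|td_roots k D|.
    by move=> /andP[_ /asboolP[R /riso_card_roots]].
  pose n := #|td_roots k B0|.
  have n_gt0 : 0 < n by apply/card_gt0P; exists v0.
  (* [B] is related to the component of [f v], and so is [B0], since members of [Bs] have the same
     partners as [B0]. *)
  have BsT B v : B \in Bs -> v \in S -> B = CG v -> v \in td_roots k B ->
      T B0 (CH (f v)).
    rewrite inE => /andP[_ /eqP eN] vS eB rv; rewrite eB in rv.
    have [t _] := rootT v vS rv; rewrite -eB in t.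
    by move: t; rewrite -(in_set (T B)) eN in_set.
  have Bs_n B : B \in Bs -> #|td_roots k B| = n.
    move=> BB; have BP : B \in PS by move: BB; rewrite inE => /andP[].
    have [v rv [vS eB]] := PSroot _ BP; have t := BsT _ _ BB vS eB rv.
    rewrite /n (Troots _ _ t); rewrite eB in rv *.
    by have [/Troots] := rootT v vS rv.
  (* [U] and [W] are the roots of the components in [Bs] and in [Ds], with [n] roots in each
     component. As [f] maps [U] into [W], the product of [#|Bs|] and [n] is at most that of [#|Ds|]
     and [n], and [n] is positive. *)
  pose U := [set u in S | (CG u \in Bs) && (u \in td_roots k (CG u))].
  pose W := [set w | [&& w \notin b, CH w \in Ds & w \in td_roots k (CH w)]].
  have inU u : (u \in U) = [&& u \in S, CG u \in Bs & u \in td_roots k (CG u)].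
    by rewrite in_set.
  have inW w : (w \in W) = [&& w \notin b, CH w \in Ds & w \in td_roots k (CH w)].
    by rewrite in_set.
  have cU : #|U| = #|Bs| * n.
    apply: (card_fibers (c := CG)) => [u|B BB]; first by rewrite inU => /and3P[].
    rewrite -(Bs_n _ BB); congr #|pred_of_set _|; apply/setP => u.
    rewrite in_set inU; apply/idP/idP => [/andP[/and3P[_ _ ru] /eqP <-]//|ru].
    have uB : u \in B by move: ru; rewrite in_td_roots => /andP[].
    have BP : B \in PS by move: BB; rewrite inE => /andP[].
    have [v _ [vS eB]] := PSroot _ BP.
    have uC : u \in component S v by rewrite CS // -eB.
    have uS : u \in S by apply: (subsetP (component_sub vS)).
    have -> : CG u = B by rewrite -CS // (component_eq uC) CS.
    by rewrite uS BB ru eqxx.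
  have cW : #|W| = #|Ds| * n.
    apply: (card_fibers (c := CH)) => [w|D DD]; first by rewrite inW => /and3P[].
    have DT : T B0 D by move: DD; rewrite inE.
    rewrite /n (Troots _ _ DT); congr #|pred_of_set _|; apply/setP => w.
    rewrite in_set inW; apply/idP/idP => [/andP[/and3P[_ _ rw] /eqP <-]//|rw].
    have wD : w \in D by move: rw; rewrite in_td_roots => /andP[].
    have /imsetP[z zb eD] : D \in PH by case/andP: DT.
    have wC : w \in CH z by rewrite -eD.
    have := subsetP (component_sub zb) _ wC; rewrite inE => ->.
    have -> : CH w = D by rewrite eD; apply: component_eq.
    by rewrite DD rw eqxx.
  rewrite -(leq_pmul2r n_gt0) -cU -cW -(card_imset _ (bij_inj bf)).
  apply: subset_leq_card; apply/subsetP => _ /imsetP[u + ->].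
  rewrite inU inW => /and3P[uS uB ru].
  have [_ [-> ->]] := rootT u uS ru; rewrite andbT /= in_set.
  exact: (BsT (CG u) u).
exists h => // u uS; have /andP[/imsetP[w wb ->] i] := hT _ (imset_f _ uS).
by exists w => //; move: wb; rewrite inE.
Qed.

(** The isomorphisms of the components are glued. Injectivity of [h] sends distinct components to
    distinct components, so no edge joins different pieces on either side; this is [hcase]. *)
Lemma rooted_transferS k :
  rooted_transfer k -> transfer k.+1.
Proof.
move=> tr a b S E regS tdS.
have [h injh hP] := component_matching tr E regS tdS.
(* The implication is placed under the existential so that a relation can be chosen for every set,
   matched or not. *)
have exR (B : {set G}) : exists R, iso_regions a b B (h B) ->
    region_iso a b B (h B) R.
  have [/asboolP[R r]|n] := boolP (iso_regions a b B (h B)); first by exists R.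
  by exists (fun _ _ => false).
have [F FP] := fin_all_exists exR.
have isoF u : u \in S ->
    region_iso a b (component S u) (h (component S u)) (F (component S u)).
  by move=> uS; apply: FP; have [w _ []] := hP _ uS.
pose D := \bigcup_(u in S) h (component S u).
pose R u w := (u \in S) && F (component S u) u w.
have hsub u : u \in S -> region b (h (component S u)).
  by move=> uS; have [w wb [-> _]] := hP _ uS; apply: component_region.
have hcase u u' w w' : u \in S -> u' \in S -> w \in h (component S u) ->
    w' \in h (component S u') ->
    component S u = component S u' \/
    [/\ u != u', w != w', edge u u' = false & edge w w' = false].
  move=> uS u'S wD w'D; have [->|ne] := eqVneq (component S u) (component S u').
    by left.
  right.
  have neh : h (component S u) != h (component S u').
    by apply: contraNneq ne => /injh -> //; apply: imset_f.
  have [z zb [ez _]] := hP _ uS; have [z' zb' [ez' _]] := hP _ u'S.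
  have wz : w \in component (unpebbled b) z by rewrite -ez.
  have wz' : w' \in component (unpebbled b) z' by rewrite -ez'.
  have nCw : w \notin component (unpebbled b) w'.
    apply: contraNN neh => ww; rewrite ez ez' -(component_eq wz) -(component_eq wz').
    exact/eqP/component_eq.
  have nCu : u \notin component S u'.
    by apply: contraNN ne => uu; apply/eqP/component_eq.
  have [subh _] := hsub _ uS; have [subh' _] := hsub _ u'S.
  split.
  - by apply: contraNneq ne => ->.
  - by apply: contraNneq nCw => ->; apply: mem_component.
  - apply: contraNF nCu => uu.
    by apply: component_closed (mem_component _ _) u'S uS _; rewrite edge_sym.
  - apply: contraNF nCw => ww.
    apply: component_closed (mem_component _ _) _ _ _; last by rewrite edge_sym.
      exact: (subsetP subh').
    exact: (subsetP subh).
have Fsub u w : R u w ->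
    [/\ u \in S, w \in h (component S u) & F (component S u) u w].
  by move=> /andP[uS r]; have [_ ->] := riso_sub (isoF _ uS) r.
exists D, R; split.
  split.
    by apply/bigcupsP => u uS; case: (hsub _ uS).
  move=> w w' /bigcupP[u uS wD] w'b ww; apply/bigcupP; exists u => //.
  by have [_ cl] := hsub _ uS; apply: cl wD w'b ww.
split.
- by move=> u w /Fsub[uS wD _]; split=> //; apply/bigcupP; exists u.
- move=> u uS; have [w r] := riso_dom (isoF _ uS) (mem_component _ _).
  by exists w; rewrite /R uS.
- move=> w /bigcupP[u uS wD]; have [v r] := riso_ran (isoF _ uS) wD.
  have [vC _] := riso_sub (isoF _ uS) r; exists v.
  by rewrite /R (component_eq vC) r (subsetP (component_sub uS) _ vC).
- move=> u w u' w' /Fsub[uS wD r] /Fsub[u'S w'D r'].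
  have [e|[/negPf-> /negPf->]//] := hcase _ _ _ _ uS u'S wD w'D.
  by rewrite -e in r'; apply: (riso_eq (isoF _ uS)).
- move=> u w u' w' /Fsub[uS wD r] /Fsub[u'S w'D r'].
  have [e|[_ _ -> ->]//] := hcase _ _ _ _ uS u'S wD w'D.
  by rewrite -e in r'; apply: (riso_edge (isoF _ uS)).
- by move=> u w /Fsub[uS _ r]; apply: (riso_color (isoF _ uS)).
- by move=> u w /Fsub[uS _ r]; apply: (riso_adj (isoF _ uS)).
Qed.

Lemma transferP k : transfer k.
Proof.
elim: k => [a b S _ _ /eqP ->|k IH]; last exact/rooted_transferS/transfer_rooted.
exists set0, (fun _ _ => false); split.
  by split=> [|u v]; rewrite ?sub0set ?inE.
by split=> // u; rewrite inE.
Qed.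

(** Without pebbles all of [G] is a region, but [transferP] only reaches some union of components of
    [H]. The bijection of the first round gives equal cardinalities, so this union is all of [H]. *)
Lemma eqv_isomorphic d : td G <= d ->
  eqv d.+1 ([::] : seq G) ([::] : seq H) -> isomorphic G H.
Proof.
move=> tdG E; have regT : region [::] [set: G].
  by split=> [|u v _ _ _]; rewrite ?inE //; apply/subsetP => u; rewrite inE.
have [D [R [_ iso]]] := transferP E regT (td_set_tdle tdG).
have [f fP] := fin_all_exists (fun u => riso_dom iso (in_setT u)).
have injf : injective f.
  by move=> u v fuv; apply/eqP; rewrite (riso_eq iso (fP u) (fP v)) fuv.
have cGH : #|H| <= #|G|.
  by have [g /bij_eq_card ->] := eqv_step E.
exists f; split; first exact: inj_card_bij.
- by move=> u v; rewrite (riso_edge iso (fP u) (fP v)).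
- by move=> u; rewrite (riso_color iso (fP u)).
Qed.

End Reconstruction.

(** * Hintikka formulas *)

Section Layered.
Variable C : Type.
Implicit Types phi psi : formula C.

(* The variable bound by a quantifier is determined by its depth, so that none
   is requantified. *)
Fixpoint layered n r phi : bool :=
  match phi with
  | FEq x y | FEdge x y => (0 < x <= r) && (0 < y <= r)
  | FColor _ x => 0 < x <= r
  | FNot psi => layered n r psi
  | FAnd psi chi | FOr psi chi | FImp psi chi | FIff psi chi =>
      layered n r psi && layered n r chi
  | FQuant _ x psi => [&& x == r.+1, r < n & layered n r.+1 psi]
  end.

Lemma layered_free n r phi x :
  layered n r phi -> x \in free_vars phi -> 0 < x <= r.
Proof.
elim: phi r => //= [y z|y z|c y|psi IHp chi IHc|psi IHp chi IHc|psi IHp chi IHc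
    |psi IHp chi IHc|q y psi IH] r.
1-2: by move=> /andP[? ?]; rewrite !inE => /orP[] /eqP ->.
- by move=> ?; rewrite inE => /eqP ->.
1-4: by move=> /andP[lp lc]; rewrite mem_cat => /orP[/IHp|/IHc]; apply.
move=> /and3P[/eqP -> _ lp]; rewrite mem_filter => /andP[ne /(IH _ lp)].
by rewrite (leq_eqVlt x) (negPf ne).
Qed.

Lemma layered_bound n r phi x :
  layered n r phi -> x \in bound_vars phi -> r < x <= n.
Proof.
elim: phi r => //= [psi IHp chi IHc|psi IHp chi IHc|psi IHp chi IHc
    |psi IHp chi IHc|q y psi IH] r.
1-4: by move=> /andP[lp lc]; rewrite mem_cat => /orP[/IHp|/IHc]; apply.
move=> /and3P[/eqP -> rn lp]; rewrite inE => /orP[/eqP->|/(IH _ lp)/andP[lt ->]].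
  by rewrite ltnSn.
by rewrite (ltnW lt).
Qed.

(** Used twice in succession, for a quantifier and for one in its scope: the inner variable is
    strictly larger, so it is not a requantification. *)
Lemma layered_subformula n r phi q x psi :
  layered n r phi -> subformula (FQuant q x psi) phi ->
  r < x /\ layered n x psi.
Proof.
elim: phi r => [y z|y z|c y|chi IH|f IHf g IHg|f IHf g IHg|f IHf g IHg
    |f IHf g IHg|q' y chi IH] r /=.
1-3: by move=> _ [].
- by move=> l [//|]; apply: IH.
1-4: by move=> /andP[lf lg] [//|[]]; [apply: IHf | apply: IHg].
move=> /and3P[/eqP -> rn l] [[_ -> ->]//|/(IH _ l)[lt lx]].
by split; first exact: ltnW.
Qed.

Lemma layered_sentence n phi : layered n 0 phi -> sentence phi.
Proof.
rewrite /sentence => l; case E: (free_vars phi) => [//|x s].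
have := layered_free l (_ : x \in free_vars phi).
by rewrite E mem_head => /(_ isT); case: x {E}.
Qed.

Lemma layered_C0 n phi : layered n 0 phi -> C0 n phi.
Proof.
move=> l; have free0 := layered_sentence l; rewrite /sentence in free0.
split=> x; first by rewrite free0 /=; apply: layered_bound l.
case=> [[]|[q [psi [q' [chi [s s']]]]]]; first by rewrite free0.
have [_ lx] := layered_subformula l s.
by have [] := layered_subformula lx s'; rewrite ltnn.
Qed.

Definition conjunction (phi : formula C) (s : seq (formula C)) :=
  foldr (@FAnd C) phi s.

Lemma layered_conj n r phi s :
  layered n r (conjunction phi s) = layered n r phi && all (layered n r) s.
Proof. by elim: s => [|psi s /= ->]; rewrite ?andbT //= andbCA. Qed.

End Layered.

(** * Truth of Hintikka formulas as equivalence in the game *)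

Lemma sat_conj (C : eqType) (G : cgraph C) (e : assignment G) phi s :
  sat e (conjunction phi s) = sat e phi && all (sat e) s.
Proof. by elim: s => [|psi s /= ->]; rewrite ?andbT //= andbCA. Qed.

Section Hintikka.
Variables (C : eqType).

Lemma update_asg (G : cgraph C) (a : seq G) n v : size a = n ->
  update (asg a) n.+1 v = asg (rcons a v).
Proof.
move=> <-; apply: funext => -[|i] //=; rewrite /update /= onth_rcons eqSS.
case: ltngtP => // lt; exact/onth_default/ltnW.
Qed.

Definition literal (G : cgraph C) (a : seq G) phi :=
  if sat (asg a) phi then phi else FNot phi.

Lemma sat_literal (G H : cgraph C) (a : seq G) (b : seq H) phi :
  sat (asg b) (literal a phi) = (sat (asg a) phi == sat (asg b) phi).
Proof. by rewrite /literal; case: ifP => _ /=; case: (sat (asg b) phi). Qed.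

(** Colors occur only positively: the color of a pebble decides all its color atoms, and [C] may be
    infinite. *)
Definition diagram (G : cgraph C) (a : seq G) : seq (formula C) :=
  let r := iota 1 (size a) in
  [seq literal a (FEq i j) | i <- r, j <- r]
  ++ [seq literal a (FEdge i j) | i <- r, j <- r]
  ++ [seq FColor (color p.2) p.1 | p <- zip r a].

Lemma all_diagram (G : cgraph C) (a : seq G) (P : pred (formula C)) :
  reflect
    [/\ forall i j, 0 < i <= size a -> 0 < j <= size a -> P (literal a (FEq i j)),
        forall i j, 0 < i <= size a -> 0 < j <= size a -> P (literal a (FEdge i j)) &
        forall i u, asg a i = Some u -> P (FColor (color u) i)]
    (all P (diagram a)).
Proof.
have in_r i : (i \in iota 1 (size a)) = (0 < i <= size a).
  by rewrite mem_iota add1n ltnS.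
have allE (A : Type) (f : nat -> nat -> A) (Q : pred A) : reflect
    (forall i j, 0 < i <= size a -> 0 < j <= size a -> Q (f i j))
    (all Q [seq f i j | i <- iota 1 (size a), j <- iota 1 (size a)]).
  apply: (iffP all_allpairsP) => h i j.
    by rewrite -!in_r; apply: h.
  by rewrite !in_r; apply: h.
have zipE : all P [seq FColor (color p.2) p.1 | p <- zip (iota 1 (size a)) a] <->
    forall i u, asg a i = Some u -> P (FColor (color u) i).
  have sz : size (iota 1 (size a)) = size a by rewrite size_iota.
  rewrite all_map; split=> [/allP h [//|i] u /= e|h].
    have lt : i < size a by rewrite -onthTE e.
    have := h (nth (0, u) (zip (iota 1 (size a)) a) i).
    rewrite mem_nth ?size_zip ?sz ?minnn // nth_zip //= nth_iota // add1n.
    by rewrite (onth_nth u _ _ _ e) => /(_ isT).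
  apply/allP => -[i u] /(nthP (0, u))[j]; rewrite size_zip sz minnn => lt.
  rewrite nth_zip // nth_iota // add1n => -[<- e] /=; apply: h => /=.
  by move: (lt); rewrite -onthTE -e -odflt_onth; case: onth.
rewrite /diagram !all_cat; apply: (iffP and3P) => -[h1 h2 h3]; split.
- by move: h1 => /allE.
- by move: h2 => /allE.
- exact/zipE.
- exact/allE.
- exact/allE.
- exact/zipE.
Qed.

(** The diagram mentions placed pebbles only; at any other index all atoms are false in both graphs,
    since the lengths agree. *)
Lemma sat_diagram (G H : cgraph C) (a : seq G) (b : seq H) :
  size a = size b -> all (sat (asg b)) (diagram a) <-> agree a b.
Proof.
move=> es.
have defined (K : cgraph C) (s : seq K) i : ~~ (0 < i <= size s) -> asg s i = None.
  by case: i => //= i; rewrite -leqNgt; apply: onth_default.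
split=> [/all_diagram[h1 h2 h3]|[h1 h2 h3]].
- split=> [i j|i j|c i].
  + have [ri|/negbTE] := boolP (0 < i <= size a); last first.
      by move/negbT=> ri /=; rewrite !defined -?es.
    have [rj|rj] := boolP (0 < j <= size a); last first.
      by rewrite /= (defined _ a _ rj) (defined _ b j) -?es //; do 2!case: asg.
    by have := h1 _ _ ri rj; rewrite sat_literal => /eqP.
  + have [ri|/negbTE] := boolP (0 < i <= size a); last first.
      by move/negbT=> ri /=; rewrite !defined -?es.
    have [rj|rj] := boolP (0 < j <= size a); last first.
      by rewrite /= (defined _ a _ rj) (defined _ b j) -?es //; do 2!case: asg.
    by have := h2 _ _ ri rj; rewrite sat_literal => /eqP.
  + rewrite /=; case e: (asg a i) => [u|].
      by have := h3 _ _ e; rewrite /=; case: (asg b i) => // w /eqP ->.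
    rewrite defined // -es; case: i e => //= i e.
    by rewrite -onthTE e.
apply/all_diagram; split=> [i j _ _|i j _ _|i u e].
- by rewrite sat_literal h1.
- by rewrite sat_literal h2.
- by rewrite -h3 /= e.
Qed.

Lemma diagram_layered (G : cgraph C) (a : seq G) n :
  all (layered n (size a)) (diagram a).
Proof.
apply/all_diagram; split=> [i j ri rj|i j ri rj|[//|i] u /= e].
1-2: by rewrite /literal; case: ifP; rewrite /= ri rj.
by rewrite -onthTE e.
Qed.

(* There is no constant for truth; [FEq 1 1] replaces it, which needs at least
   one pebble to be placed. *)
Fixpoint hintikka (G : cgraph C) k (a : seq G) : formula C :=
  let y := (size a).+1 in
  conjunction
    (if k is k'.+1 then
       conjunction (FNot (FQuant (QAtLeast #|G|.+1) y (FEq y y)))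
         [seq FQuant
                (QAtLeast #|[set u | sat (asg (rcons a u))
                                       (hintikka k' (rcons a v))]|)
                y (hintikka k' (rcons a v))
         | v <- enum G]
     else FEq 1 1)
    (diagram a).

Lemma hintikka_layered (G : cgraph C) k (a : seq G) n :
  size a + k <= n -> 0 < size a + k -> layered n (size a) (hintikka k a).
Proof.
elim: k a => [|k IH] a le gt0 /=; rewrite layered_conj; apply/andP; split.
- by move: gt0; rewrite addn0 /= => ->.
- exact: diagram_layered.
- have rn : size a < n by apply: leq_trans le; rewrite addnS ltnS leq_addr.
  rewrite layered_conj /= eqxx rn !ltnSn /= all_map; apply/allP => v _ /=.
  rewrite eqxx rn /= -(size_rcons a v); apply: IH; rewrite size_rcons //.
  by rewrite addSn -addnS.
- exact: diagram_layered.
Qed.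

(** The counting conjuncts bound the number of vertices of each type in [H] from below, which yields
    an injection from [G] to [H]. The conjunct bounding [#|H|] by [#|G|] makes it a bijection. *)
Lemma sat_hintikka k (G H : cgraph C) (a : seq G) (b : seq H) :
  size a = size b -> 0 < size a + k ->
  sat (asg b) (hintikka k a) <-> eqv k a b.
Proof.
elim: k G H a b => [|k IH] G H a b es gt0; cbn [hintikka]; rewrite sat_conj.
  split=> [/andP[_ /(sat_diagram es)]//|[ag _]].
  rewrite sat_eq_refl -es -(addn0 (size a)) gt0 /=; exact/sat_diagram.
have step (K : cgraph C) (s : seq K) v w : size s = size a ->
    sat (asg (rcons s w)) (hintikka k (rcons a v)) <->
    eqv k (rcons a v) (rcons s w).
  by move=> e; apply: IH; rewrite ?size_rcons ?e ?addSn.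
pose n v := #|[set u | sat (asg (rcons a u)) (hintikka k (rcons a v))]|.
pose m v := #|[set w | sat (asg (rcons b w)) (hintikka k (rcons a v))]|.
have satE : sat (asg b) (conjunction (FNot (FQuant (QAtLeast #|G|.+1) (size a).+1
          (FEq (size a).+1 (size a).+1)))
        [seq FQuant (QAtLeast (n v)) (size a).+1 (hintikka k (rcons a v))
        | v <- enum G]) <->
      #|H| <= #|G| /\ forall v, n v <= m v.
  have mE v : m v = #|[set w | sat (update (asg b) (size a).+1 w)
                                 (hintikka k (rcons a v))]|.
    by apply: eq_card => w; rewrite !inE update_asg.
  have allE : #|[set w | sat (update (asg b) (size a).+1 w)
      (@FEq C (size a).+1 (size a).+1)]| = #|H|.
    apply: eq_card => w; rewrite !inE update_asg // sat_eq_refl size_rcons es.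
    exact: ltnSn.
  rewrite sat_conj; cbn [sat]; rewrite allE -leqNgt all_map; split.
    move=> /andP[-> /allP h]; split=> // v; rewrite mE.
    by apply: h; rewrite mem_enum.
  by case=> -> h; apply/allP => v _ /=; rewrite -mE.
split=> [/andP[/satE[cHG le] /(sat_diagram es) ag]|[ag [f bf Ef]]]; last first.
  apply/andP; split; last exact/sat_diagram.
  apply/satE; split; first by rewrite (bij_eq_card bf).
  move=> v; rewrite /n -(card_imset _ (bij_inj bf)); apply: subset_leq_card.
  apply/subsetP => _ /imsetP[u + ->]; rewrite !inE => /(step _ _ _ _ erefl) E.
  by apply/step => //; apply: eqv_trans E (Ef u).
split=> //; pose T v w := sat (asg (rcons b w)) (hintikka k (rcons a v)).
have TP v w : T v w <-> eqv k (rcons a v) (rcons b w) by apply: step.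
(* The vertex [v] satisfies its own Hintikka formula in [G], so the count [n v] is positive. *)
have exT v : exists w, T v w.
  have : 0 < m v.
    apply: leq_trans (le v); apply/card_gt0P; exists v; rewrite inE.
    by apply/step => //; apply: eqv_refl.
  by case/card_gt0P => w; rewrite inE; exists w.
have [dflt dfltP] := fin_all_exists exT.
have [| |f injf fT] := @class_injection _ _ [set: G] T dflt.
- move=> v v' w w' _ _ /TP E1 /TP E2 /TP E3; apply/TP.
  exact: eqv_trans E1 (eqv_trans (eqv_sym E2) E3).
- move=> v _; apply: leq_trans (le v); apply: subset_leq_card.
  (* A vertex [u] with the same partners as [v] shares the partner [dflt u] with it; composing
     through this partner makes [u] and [v] equivalent inside [G], so [u] is counted by [n v]. *)
  apply/subsetP => u; rewrite !inE => /= /eqP eN; apply/step => //.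
  have : dflt u \in [set w | T u w] by rewrite inE.
  rewrite eN inE => /TP E; have /TP E' := dfltP u.
  exact: eqv_trans E (eqv_sym E').
exists f; first by apply: inj_card_bij => // u v; apply: injf; rewrite inE.
by move=> v; apply/TP; apply: fT; rewrite inE.
Qed.

End Hintikka.

Theorem theorem30 (C : eqType) (d : nat) (d_ge1 : 1 <= d) (G : cgraph C)
    (tdG : td G <= d) :
  identifies (@C0 C d.+1) G.
Proof.
move=> H nGH; pose a : seq G := [::]; exists (hintikka d.+1 a).
have l : layered d.+1 0 (hintikka d.+1 a) by apply: (@hintikka_layered _ _ _ a).
have asg0 (K : cgraph C) : asg ([::] : seq K) = fun=> None.
  by apply: funext => -[|i] //=; rewrite onth0n.
split; [exact: layered_C0 | exact: layered_sentence l | rewrite /models].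
rewrite -(asg0 G) -(asg0 H).
have [_ ->] := sat_hintikka (a := a) (b := a) erefl (ltn0Sn d); last exact: eqv_refl.
apply/negP => satH; apply: nGH; apply: eqv_isomorphic tdG _.
by have [E _] := sat_hintikka (a := a) (b := [::] : seq H) erefl (ltn0Sn d); apply: E.
Qed.
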